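(* Let $r_c$, $z_c$, $n_c$ be mutually independent real random variables with $z_c\sim\mathcal{N}(0,\mathsf{Z}_c)$, $n_c\sim\mathcal{N}(0,N_0)$ (where $\mathsf{Z}_c\ge0$, $N_0>0$), and $\mathbb{E}[|r_c|^2]\le\mathsf{R}_c$. Let $Q_c:\mathbb{R}\to\mathfrak{Q}_c$ be a scalar quantizer with $M\ge2$ levels and set $q_c=Q_c(r_c+z_c+n_c)$. Define $\mathsf{SINR}_c=\mathsf{R}_c/(\mathsf{Z}_c+N_0)$. Then $$ I(q_c;\,r_c\mid z_c+n_c)\;\le\;\bar{\iota}(M,\mathsf{SINR}_c). $$
   Context: A scalar quantizer with $M$ levels is a map $Q:\mathbb{R}\to\mathfrak{Q}$ with $|\mathfrak{Q}|=M$ that partitions $\mathbb{R}$ into $M$ intervals separated by at most $M-1$ boundary points and maps each interval to a distinct level (it may be non-uniform). Logarithms are base 2. $H_b(x)=-x\log x-(1-x)\log(1-x)$ is the binary entropy function and $\bar H_b(x)=H_b(\min\{x,1/2\})$. $\mathrm{erf}(x)=\frac{2}{\sqrt{\pi}}\int_0^x e^{-t^2}dt$ and $\mathrm{erfc}=1-\mathrm{erf}$. Define $$\bar f(M,\mathsf{SINR})=\mathrm{erf}\Big(\tfrac{(M-1)\sqrt{\mathsf{SINR}}}{\sqrt2}\Big)+\sqrt{\tfrac{2}{\pi}}(M-1)\sqrt{\mathsf{SINR}}\exp\Big(-\tfrac{(M-1)^2\mathsf{SINR}}{2}\Big)-(M-1)^2\,\mathsf{SINR}\,\mathrm{erfc}\Big(\tfrac{(M-1)\sqrt{\mathsf{SINR}}}{\sqrt2}\Big)$$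 and $$\bar\iota(M,\mathsf{SINR})=\min\Big\{\log M,\ \bar H_b\big(\bar f(M,\mathsf{SINR})\big)+\bar f(M,\mathsf{SINR})\log(M-1)\Big\}.$$ *)

(* Defs.v *)
From HB Require Import structures.
From mathcomp Require Import all_boot all_order all_algebra.
From mathcomp Require Import all_classical all_reals all_analysis.
Set Implicit Arguments. Unset Strict Implicit. Unset Printing Implicit Defensive.
Import Order.TTheory GRing.Theory Num.Theory.
Import numFieldNormedType.Exports.
Local Open Scope classical_set_scope.
Local Open Scope ring_scope.

Section Defs.
Context {R : realType}.

Definition log2 (x : R) : R := ln x / ln 2.

Definition xlog2 (x : R) : R := if x == 0 then 0 else x * log2 x.

Definition Hb (x : R) : R := - xlog2 x - xlog2 (1 - x).
Definition Hbar (x : R) : R := Hb (Num.min x (2^-1)).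

Definition erf (x : R) : R :=
  2 / Num.sqrt pi *
  (if 0 <= x then fine (\int[lebesgue_measure]_(t in `[0%R, x]%classic) (expR (- t ^+ 2))%:E)%E
   else - fine (\int[lebesgue_measure]_(t in `[x, 0%R]%classic) (expR (- t ^+ 2))%:E)%E).
Definition erfc (x : R) : R := 1 - erf x.

Definition fbar (M : nat) (s : R) : R :=
  let a := (M%:R - 1) * Num.sqrt s in
  erf (a / Num.sqrt 2)
  + Num.sqrt (2 / pi) * a * expR (- ((M%:R - 1) ^+ 2 * s) / 2)
  - (M%:R - 1) ^+ 2 * s * erfc (a / Num.sqrt 2).

Definition iotabar (M : nat) (s : R) : R :=
  Num.min (log2 M%:R) (Hbar (fbar M s) + fbar M s * log2 (M%:R - 1)).

(** scalar quantizer with M levels: its set of levels is a set of exactly M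
    distinct reals, and each level set (preimage of a level) is an interval. *)
Definition scalar_quantizer (M : nat) (Q : R -> R) : Prop :=
  exists L : seq R, [/\ uniq L, size L = M, (forall x, Q x \in L) &
    (forall x y w, x <= w -> w <= y -> Q x = Q y -> Q w = Q x)].

Definition gaussian_law (v : R) (A : set R) : \bar R :=
  if v == 0 then (\1_A (0 : R))%:E else normal_prob 0 (Num.sqrt v) A.

Variables (d : measure_display) (T : measurableType d) (P : probability T R).

Definition has_gaussian_law (X : T -> R) (v : R) : Prop :=
  forall A : set R, measurable A -> P (X @^-1` A) = gaussian_law v A.

Definition mutually_independent3 (X Y Z : T -> R) : Prop :=
  forall A B C : set R, measurable A -> measurable B -> measurable C ->
    P (X @^-1` A `&` Y @^-1` B `&` Z @^-1` C) =
    (P (X @^-1` A) * P (Y @^-1` B) * P (Z @^-1` C))%E.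

Definition disc_MI {dA dB} {A : measurableType dA} {B : measurableType dB}
  (X : T -> A) (Y : T -> B) (m n : nat) (f : A -> 'I_m) (g : B -> 'I_n) : R :=
  \sum_(i < m) \sum_(j < n)
    let pij := fine (P [set t | f (X t) = i /\ g (Y t) = j]) in
    let pi := fine (P [set t | f (X t) = i]) in
    let pj := fine (P [set t | g (Y t) = j]) in
    if pij == 0 then 0 else pij * log2 (pij / (pi * pj)).

Definition measurable_partition {dA} {A : measurableType dA} (m : nat)
  (f : A -> 'I_m) : Prop := forall i, measurable (f @^-1` [set i]).

(** general (Dobrushin/Pinsker) mutual information: supremum over finite
    measurable partitions of the discrete mutual informations *)
Definition MI {dA dB} {A : measurableType dA} {B : measurableType dB}
  (X : T -> A) (Y : T -> B) : \bar R :=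
  ereal_sup [set x | exists (m n : nat) (f : A -> 'I_m) (g : B -> 'I_n),
    [/\ measurable_partition f, measurable_partition g &
        x = (disc_MI X Y f g)%:E]].

(** conditional mutual information I(X;Y|Z) := I(X;(Y,Z)) - I(X;Z)
    (Kolmogorov/Dobrushin chain-rule definition; well defined when I(X;Z) < oo) *)
Definition CMI {dA dB dC} {A : measurableType dA} {B : measurableType dB}
  {C : measurableType dC} (X : T -> A) (Y : T -> B) (Z : T -> C) : \bar R :=
  (MI X (fun t => (Y t, Z t)) - MI X Z)%E.

End Defs.

(* Main.v *)
Require Import Defs.
From HB Require Import structures.
From mathcomp Require Import all_boot all_order all_algebra.
From mathcomp Require Import all_classical all_reals all_analysis.
From mathcomp Require Import measurable_realfun gauss_integral ring lra.
Set Implicit Arguments.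
Unset Strict Implicit.
Unset Printing Implicit Defensive.
Import Order.TTheory GRing.Theory Num.Theory.
Import numFieldNormedType.Exports.
Local Open Scope classical_set_scope.
Local Open Scope ring_scope.

(* Write [W = z + n], a centred Gaussian independent of [r], and [q = Q (r + W)].
   Since [q] is a function of [(r, W)], [I(q; r, W) <= H(q)], while [I(q; W)] is
   at least the mutual information of [q] and the guess [Q W]; by Fano's
   inequality the difference is at most [Hb pe + pe * log2 (M - 1)], where
   [pe = P(Q (r + W) <> Q W)].

   For fixed [h] the points [w] with [Q (h + w) <> Q w] have Lebesgue measure at
   most [2 (M - 1) |h|].  The Gaussian measure of a set [A] is at most
   [nu [-t, t] + c (|A| - 2 t)], with [c] the density at [t].  For
   [t = (M - 1) sqrt Rc] this bound is affine in [|h|], so integrating it over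
   the law of [r], with [E |r| <= sqrt Rc], gives
   [pe <= nu [-t, t] = erf ((M - 1) sqrt (SINR / 2))].  This is the first term
   of [fbar]; the other two add up to a nonnegative number by Mills' bound. *)

(** * Entropy and Fano's inequality *)

Section Entropy.
Variable R : realType.
Implicit Types (x y p w : R).

Lemma ln2_gt0 : 0 < ln 2 :> R.
Proof. by rewrite ln_gt0 // ltr1n. Qed.

Lemma xlog2E x : xlog2 x = x * log2 x.
Proof. by rewrite /xlog2; case: eqVneq => [->|_]; rewrite ?mul0r. Qed.

Lemma log2M x y : 0 < x -> 0 < y -> log2 (x * y) = log2 x + log2 y.
Proof. by move=> x0 y0; rewrite /log2 lnM ?posrE // mulrDl. Qed.

Lemma log2V x : 0 < x -> log2 x^-1 = - log2 x.
Proof. by move=> x0; rewrite /log2 lnV ?posrE // mulNr. Qed.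

Lemma log2_div x y : 0 < x -> 0 < y -> log2 (x / y) = log2 x - log2 y.
Proof. by move=> x0 y0; rewrite log2M ?invr_gt0 // log2V. Qed.

Lemma ler_log2 x y : 0 < x -> x <= y -> log2 x <= log2 y.
Proof.
move=> x0 xy; rewrite /log2 ler_pM2r ?invr_gt0 ?ln2_gt0 //.
by rewrite ler_ln ?posrE // (lt_le_trans x0).
Qed.

Lemma log2_ge0 x : 1 <= x -> 0 <= log2 x.
Proof. by move=> x1; apply: divr_ge0; [exact: ln_ge0|exact: ltW ln2_gt0]. Qed.

(* Tangent-line form of Gibbs' inequality; summing it over a distribution [p]
   and a subdistribution [w] bounds the entropy of [p] by the cross entropy. *)
Lemma gibbs_term p w : 0 <= p -> 0 <= w -> (0 < p -> 0 < w) ->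
  - (p * log2 p) <= - (p * log2 w) + (w - p) / ln 2.
Proof.
rewrite le_eqVlt => /predU1P[<- w0 _|p0 _ /(_ p0) w0].
  by rewrite !mul0r oppr0 add0r addr0 divr_ge0 // ltW ?ln2_gt0.
have h : ln (w / p) <= w / p - 1.
  by have := @le_ln1Dx R (w / p - 1); rewrite subrKC; apply; rewrite ltrBDl subrr divr_gt0.
have {h} : p * ln (w / p) <= w - p.
  rewrite -(ler_pM2l p0) in h; apply: (le_trans h).
  by rewrite mulrBr mulr1 mulrC divfK ?gt_eqF.
rewrite lnM ?posrE ?invr_gt0 // lnV ?posrE // => h.
have : p * (ln w - ln p) / ln 2 <= (w - p) / ln 2.
  by rewrite ler_pM2r ?invr_gt0 ?ln2_gt0.
rewrite /log2 mulrBr mulrBl !mulrA; lra.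
Qed.

(** Gibbs' inequality against the uniform weights [M%:R^-1]: the cross entropy is then [log2 M%:R],
    and the linear corrections sum to zero. *)
Lemma entropy_le_log_card (M : nat) (p : 'I_M -> R) :
  (0 < M)%N -> (forall i, 0 <= p i) -> \sum_i p i = 1 ->
  - \sum_i xlog2 (p i) <= log2 M%:R.
Proof.
move=> M0 p0 p1; have M0' : 0 < M%:R :> R by rewrite ltr0n.
have -> : log2 M%:R = \sum_i (- (p i * log2 M%:R^-1) + (M%:R^-1 - p i) / ln 2) :> R.
  rewrite big_split /= -mulr_suml sumrB sumr_const card_ord p1.
  have -> : M%:R^-1 *+ M = 1 :> R by rewrite -[LHS]mulr_natr mulVf ?gt_eqF.
  by rewrite subrr mul0r addr0 sumrN -mulr_suml p1 mul1r log2V // opprK.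
rewrite -sumrN; apply: ler_sum => i _; rewrite xlog2E.
by apply: gibbs_term => //; rewrite ?invr_ge0 ?invr_gt0 // ltW.
Qed.

(** Gibbs' inequality for the two-point laws [(x, 1 - x)] and [(m, 1 - m)] gives [Hb x <= Hb m + (x
    - m) * (log2 (1 - m) - log2 m)]. The product is nonpositive: either [x <= y = m <= 1/2], or
    [m = 1/2] and the two logarithms agree. *)
Lemma Hb_le_Hbar x y : 0 <= x <= 1 -> x <= y -> Hb x <= Hbar y.
Proof.
move=> /andP[x0 x1] xy; rewrite /Hbar; set m := Num.min y 2^-1.
have m0 : 0 <= m by rewrite le_min (le_trans x0 xy) invr_ge0 /= ler0n.
have m2 : m <= 2^-1 by rewrite ge_min lexx orbT.
move: m0; rewrite le_eqVlt => /predU1P[m0|m0].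
  have y0 : y = 0.
    move: m0; rewrite /m; case: leP => [_ <- //|_ /eqP].
    by rewrite eq_sym invr_eq0 pnatr_eq0.
  by have -> : x = m by apply/eqP; rewrite eq_le -m0 x0 andbT -y0.
have h1 : 0 < 1 - m by lra.
have h : (x - m) * (log2 (1 - m) - log2 m) <= 0.
  have : 0 <= log2 (1 - m) - log2 m.
    by rewrite subr_ge0; apply: ler_log2 => //; lra.
  rewrite /m; case: (leP y 2^-1) => [_ h|_ _].
    by apply: mulr_le0_ge0 => //; rewrite subr_le0.
  have -> : 1 - 2^-1 = 2^-1 :> R by lra.
  by rewrite subrr mulr0.
have := @gibbs_term x m x0 (ltW m0) (fun=> m0).
have := @gibbs_term (1 - x) (1 - m) _ (ltW h1) (fun=> h1).
rewrite subr_ge0 => /(_ x1).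
have -> : (1 - m - (1 - x)) / ln 2 = - ((m - x) / ln 2) by rewrite -mulNr; congr (_ / _); lra.
rewrite /Hb !xlog2E; lra.
Qed.

Section Fano.
Variables (M : nat) (J : 'I_M -> 'I_M -> R).
Hypothesis (M2 : (2 <= M)%N) (J0 : forall i j, 0 <= J i j).
Hypothesis (J1 : \sum_i \sum_j J i j = 1).
Let pX i := \sum_j J i j.
Let pY j := \sum_i J i j.
Let pe := 1 - \sum_i J i i.

(** The left side is the conditional entropy of the row index given the column index. Gibbs'
    inequality compares [J i j] with [w i j * pY j], where [w] keeps the index with probability
    [1 - pe] and spreads [pe] evenly over the [M - 1] others; once [pY] cancels, the cross entropy
    is the right side. *)
Lemma fano :
  - \sum_i xlog2 (pX i) - \sum_i \sum_j
      (if J i j == 0 then 0 else J i j * log2 (J i j / (pX i * pY j)))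
  <= Hb pe + pe * log2 (M%:R - 1).
Proof.
pose w (i j : 'I_M) : R := if i == j then 1 - pe else pe / (M%:R - 1).
have M1 : 0 < M%:R - 1 :> R by rewrite subr_gt0 ltr1n.
have JleX i j : J i j <= pX i.
  by rewrite /pX (bigD1 j) //= lerDl sumr_ge0.
have JleY i j : J i j <= pY j.
  by rewrite /pY (bigD1 i) //= lerDl sumr_ge0.
have rowE i : pX i = J i i + \sum_(j | j != i) J i j by rewrite /pX (bigD1 i).
have peE : pe = \sum_i \sum_(j | j != i) J i j.
  rewrite /pe -J1; under eq_bigr do rewrite -/(pX _) rowE.
  by rewrite big_split /= addrAC subrr add0r.
have pe0 : 0 <= pe by rewrite peE; do 2 apply: sumr_ge0 => ? _.
have pe1 : 0 <= 1 - pe by rewrite /pe subKr sumr_ge0.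
have w0 i j : 0 <= w i j.
  by rewrite /w; case: ifP => // _; rewrite divr_ge0 // ltW.
(* Gibbs' inequality needs [w] positive wherever [J] is: a diagonal entry is part of [1 - pe], an
   off-diagonal one is part of [pe]. *)
have wJ i j : 0 < J i j -> 0 < w i j.
  rewrite /w; case: eqVneq => [->|ij] Jij.
    apply: (lt_le_trans Jij); rewrite /pe subKr (bigD1 j) //= lerDl.
    by apply: sumr_ge0.
  apply: divr_gt0 => //; apply: (lt_le_trans Jij); rewrite peE (bigD1 i) //=.
  rewrite (bigD1 j) 1?eq_sym //= -addrA lerDl addr_ge0 ?sumr_ge0 // => k _.
  by apply: sumr_ge0.
have wsum : \sum_i \sum_j w i j * pY j = 1.
  rewrite exchange_big /=; under eq_bigr do rewrite -mulr_suml.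
  have wcol j : \sum_i w i j = 1.
    rewrite (bigD1 j) //= /w eqxx.
    under eq_bigr => i /negbTE -> do [].
    rewrite sumr_const cardC1 card_ord -[_ *+ _]mulr_natr -subn1 natrB ?(ltnW M2) //.
    by rewrite divfK ?gt_eqF // subrK.
  under eq_bigr do rewrite wcol mul1r.
  by rewrite -J1 exchange_big.
have -> : Hb pe + pe * log2 (M%:R - 1) =
    \sum_i \sum_j (- (J i j * log2 (w i j)) + (w i j * pY j - J i j) / ln 2).
  under eq_bigr do rewrite big_split /= -mulr_suml sumrB sumrN.
  rewrite big_split /= -mulr_suml sumrB J1 wsum subrr mul0r addr0 sumrN.
  have -> : \sum_i \sum_j J i j * log2 (w i j) =
     (1 - pe) * log2 (1 - pe) + pe * log2 (pe / (M%:R - 1)).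
    under eq_bigr => i _.
      rewrite (bigD1 i) //= {1}/w eqxx.
      under eq_bigr => j ji do rewrite /w eq_sym (negbTE ji).
      rewrite -mulr_suml; over.
    by rewrite big_split /= -!mulr_suml -peE /pe subKr.
  (* For [pe = 0] the logarithm of the quotient cannot be split, but its factor [pe] vanishes. *)
  rewrite /Hb !xlog2E; move: pe0; rewrite le_eqVlt => /predU1P[<-|pe0].
    by rewrite !mul0r; lra.
  by rewrite log2_div //; lra.
rewrite -!sumrN -big_split /=; apply: ler_sum => i _.
rewrite xlog2E {1}/pX mulr_suml -!sumrN -big_split /=; apply: ler_sum => j _.
case: eqVneq => [->|Jn0].
  rewrite !(mul0r, oppr0, addr0, add0r) mulr_ge0 ?invr_ge0 ?(ltW ln2_gt0) //.
  by rewrite mulr_ge0 // /pY sumr_ge0.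
have Jgt0 : 0 < J i j by rewrite lt_neqAle eq_sym Jn0 J0.
have X0 := lt_le_trans Jgt0 (JleX i j).
have Y0 := lt_le_trans Jgt0 (JleY i j).
have W0 := wJ _ _ Jgt0.
have WY0 : 0 < w i j * pY j by rewrite mulr_gt0.
have := @gibbs_term (J i j) (w i j * pY j) (J0 _ _) (ltW WY0) (fun=> WY0).
rewrite log2_div ?mulr_gt0 // !log2M //; lra.
Qed.

End Fano.
End Entropy.

(** * Mutual information *)

Section MutualInformation.
Variables (R : realType) (d : measure_display) (T : measurableType d).
Variable P : probability T R.

Lemma fine_prob_ge0 (A : set T) : 0 <= fine (P A).
Proof. by apply: fine_ge0. Qed.

Lemma le_fine_prob (A B : set T) : measurable A -> measurable B ->
  A `<=` B -> fine (P A) <= fine (P B).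
Proof.
move=> mA mB AB; apply: fine_le; rewrite ?fin_num_measure //.
by apply: le_measure => //; rewrite inE.
Qed.

Lemma fine_prob_fibers n (h : T -> 'I_n) (A : set T) : measurable A ->
  (forall i, measurable (h @^-1` [set i])) ->
  fine (P A) = \sum_i fine (P (A `&` h @^-1` [set i])).
Proof.
move=> mA mh; have mAh i : measurable (A `&` h @^-1` [set i]) by exact: measurableI.
rewrite sum_fine => [|i _]; last exact: fin_num_measure.
rewrite -(@measure_bigsetU_ord _ _ _ P _ xpredT) //; last first.
  by move=> i j _ _ [t [[_ <-] [_ <-]]].
congr (fine (P _)); apply/seteqP; split=> t.
  by move=> At; rewrite (bigD1 (h t)) //=; left.
by elim/big_ind: _ => // [B C IB IC [/IB|/IC]|i _ []].
Qed.

Lemma measurable_fiber dC (C : measurableType dC) (X : T -> C) m (f : C -> 'I_m) i :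
  measurable_fun setT X -> measurable_partition f ->
  measurable ((f \o X) @^-1` [set i]).
Proof. by move=> mX mf; rewrite -[X in measurable X]setTI comp_preimage; exact: mX. Qed.

Variables (dA dB : measure_display) (A : measurableType dA) (B : measurableType dB).

(** A discrete mutual information is at most the entropy of [f \o X]. Since [u] separates the values
    of [X], [f \o X] is a function of [u \o X], and coarsening does not raise entropy. *)
Lemma disc_MI_le_entropy (X : T -> A) (Y : T -> B) (m n M : nat)
    (f : A -> 'I_m) (g : B -> 'I_n) (u : A -> 'I_M) :
  measurable_fun setT X -> measurable_fun setT Y ->
  measurable_partition f -> measurable_partition g -> measurable_partition u ->
  (forall t t', u (X t) = u (X t') -> X t = X t') ->
  disc_MI P X Y f g <= - \sum_k xlog2 (fine (P ((u \o X) @^-1` [set k]))).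
Proof.
move=> mX mY mf mg mu uinj.
have mF i := measurable_fiber i mX mf.
have mG j := measurable_fiber j mY mg.
have mU k := measurable_fiber k mX mu.
pose p i := fine (P ((f \o X) @^-1` [set i])).
pose s k := fine (P ((u \o X) @^-1` [set k])).
pose K i k := fine (P ((f \o X) @^-1` [set i] `&` (u \o X) @^-1` [set k])).
pose J i j := fine (P ((f \o X) @^-1` [set i] `&` (g \o Y) @^-1` [set j])).
have pK i : p i = \sum_k K i k by exact: fine_prob_fibers.
have pJ i : p i = \sum_j J i j by exact: fine_prob_fibers.
have sK k : s k = \sum_i K i k.
  rewrite /s (@fine_prob_fibers _ (f \o X)) //; apply: eq_bigr => i _.
  by rewrite setIC.
(* A cell of [u \o X] that meets a cell of [f \o X] lies inside it, because [X] is constant on the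
   former. *)
have Ks i k : K i k != 0 -> s k <= K i k.
  move=> K0; have [t [/= ft ut]] : (f \o X) @^-1` [set i] `&` (u \o X) @^-1` [set k] !=set0.
    by apply/set0P; apply: contraNN K0 => /eqP h; rewrite /K h measure0.
  apply: le_fine_prob => //; first exact: measurableI.
  by move=> t' /= ut'; split => //=; rewrite (uinj t' t) // ut.
have Kp i k : K i k <= p i.
  by apply: le_fine_prob => //; exact: measurableI.
have K0 i k : 0 <= K i k by exact: fine_prob_ge0.
have Ksle i k : K i k <= s k.
  by apply: le_fine_prob => //; exact: measurableI.
(* The middle term is the entropy of [f \o X]; it comes from bounding each joint probability by its
   column marginal. *)
apply: (@le_trans _ _ (\sum_i \sum_j J i j * - log2 (p i))).
  apply: ler_sum => i _; apply: ler_sum => j _ /=.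
  rewrite -/(J i j) -/(p i); set q := fine (P [set t | g (Y t) = j]).
  case: eqVneq => [->|J0]; first by rewrite mul0r.
  have Jgt : 0 < J i j by rewrite lt_neqAle eq_sym J0 fine_prob_ge0.
  have Jp : J i j <= p i by apply: le_fine_prob => //; exact: measurableI.
  have Jq : J i j <= q.
    by apply: le_fine_prob => //; [exact: measurableI|exact: mG].
  have p0 := lt_le_trans Jgt Jp; have q0 := lt_le_trans Jgt Jq.
  rewrite ler_pM2l // log2_div ?mulr_gt0 // log2M //.
  have := ler_log2 Jgt Jq; lra.
(* Each [p i] is split over the cells of [u \o X]; where [K i k] is nonzero, [s k <= p i] compares
   the logarithms. *)
under eq_bigr do rewrite -mulr_suml -pJ pK mulr_suml.
rewrite exchange_big /= -sumrN; apply: ler_sum => k _.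
rewrite xlog2E -mulrN -/(s k) sK mulr_suml; apply: ler_sum => i _.
rewrite -pK -sK; have [->|Kn0] := eqVneq (K i k) 0; first by rewrite !mul0r.
have Kgt : 0 < K i k by rewrite lt_neqAle eq_sym Kn0 K0.
rewrite ler_pM2l // lerN2; apply: ler_log2; first exact: lt_le_trans (Ksle i k).
exact: le_trans (Ks _ _ Kn0) _.
Qed.

(** One-cell partitions already contribute the value zero to the supremum. *)
Lemma MI_ge0 (X : T -> A) (Y : T -> B) : (0 <= MI P X Y)%E.
Proof.
apply: ereal_sup_ubound; exists 1%N, 1%N, (fun=> ord0), (fun=> ord0).
have mc dC (C : measurableType dC) : measurable_partition (fun _ : C => @ord0 0).
  move=> i; rewrite (_ : _ @^-1` _ = setT) //.
  by apply/seteqP; split => // x _ /=; rewrite (ord1 i).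
split => //; rewrite /disc_MI !big_ord1.
have -> : [set t : T | @ord0 0 = ord0 /\ @ord0 0 = ord0] = setT.
  by apply/seteqP; split.
have -> : [set t : T | @ord0 0 = ord0] = setT by apply/seteqP; split.
by rewrite probability_setT /= oner_eq0 !mul1r invr1 /log2 ln1 mul0r.
Qed.

Lemma measurable_eq_fibers (X : T -> A) (Y : T -> B) (M : nat)
    (u : A -> 'I_M) (v : B -> 'I_M) :
  measurable_fun setT X -> measurable_fun setT Y ->
  measurable_partition u -> measurable_partition v ->
  measurable [set t | u (X t) = v (Y t)].
Proof.
move=> mX mY mu mv.
rewrite (_ : [set t | _] = \big[setU/set0]_(i < M)
   ((u \o X) @^-1` [set i] `&` (v \o Y) @^-1` [set i])).
  apply: bigsetU_measurable => i _.
  by apply: measurableI; exact: measurable_fiber.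
apply/seteqP; split=> t /=.
  by move=> e; rewrite (bigD1 (u (X t))) //=; left; split.
by elim/big_ind: _ => // [C D IB IC [/IB|/IC] //|i _ [/= -> ->]].
Qed.

(** [J] is the joint law of [u \o X] and its guess [v \o Y], so its diagonal carries the probability
    of a correct guess. *)
Lemma disc_MI_fano (X : T -> A) (Y : T -> B) (M : nat)
    (u : A -> 'I_M) (v : B -> 'I_M) : (2 <= M)%N ->
  measurable_fun setT X -> measurable_fun setT Y ->
  measurable_partition u -> measurable_partition v ->
  - \sum_k xlog2 (fine (P ((u \o X) @^-1` [set k]))) - disc_MI P X Y u v
  <= Hb (fine (P [set t | u (X t) != v (Y t)])) +
     fine (P [set t | u (X t) != v (Y t)]) * log2 (M%:R - 1).
Proof.
move=> M2 mX mY mu mv; set pe := fine (P [set t | u (X t) != v (Y t)]).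
have mU i := measurable_fiber i mX mu.
have mV j := measurable_fiber j mY mv.
pose J i j := fine (P ((u \o X) @^-1` [set i] `&` (v \o Y) @^-1` [set j])).
have JX i : fine (P ((u \o X) @^-1` [set i])) = \sum_j J i j by exact: fine_prob_fibers.
have JY j : fine (P ((v \o Y) @^-1` [set j])) = \sum_i J i j.
  rewrite (@fine_prob_fibers _ (u \o X)) //; apply: eq_bigr => i _.
  by rewrite setIC.
have fPT : fine (P setT) = 1 by rewrite probability_setT.
have J1 : \sum_i \sum_j J i j = 1.
  rewrite -fPT (@fine_prob_fibers _ (u \o X)) //; apply: eq_bigr => i _.
  by rewrite setTI.
have mE := measurable_eq_fibers mX mY mu mv.
have peE : pe = 1 - \sum_i J i i.
  have -> : \sum_i J i i = fine (P [set t | u (X t) = v (Y t)]).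
    rewrite (@fine_prob_fibers _ (u \o X)) //; apply: eq_bigr => i _.
    congr (fine (P _)); apply/seteqP; split=> t /=.
      by move=> [/= -> ->].
    by move=> [/= e1 e2]; rewrite -e1 e2.
  rewrite /pe (_ : [set t | u (X t) != v (Y t)] = ~` [set t | u (X t) = v (Y t)]).
    by rewrite probability_setC // fineB ?fin_num_measure.
  by apply/seteqP; split=> t /= /eqP.
have := @fano R M J M2 (fun i j => fine_prob_ge0 _) J1.
rewrite -peE; apply: le_trans; rewrite le_eqVlt; apply/orP; left; apply/eqP.
congr (_ - _).
  by congr (- _); apply: eq_bigr => i _; rewrite JX.
by apply: eq_bigr => i _; apply: eq_bigr => j _; rewrite -JX -JY.
Qed.

End MutualInformation.

(* The entropy of [X] bounds the first mutual information in [CMI] from above;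
   the second is bounded from below by [0], or by Fano's inequality for the
   guess [v \o Z] of [u \o X]. *)
Lemma CMI_le (R : realType) (d : measure_display) (T : measurableType d)
    (P : probability T R) (dA dB dC : measure_display) (A : measurableType dA)
    (B : measurableType dB) (C : measurableType dC)
    (X : T -> A) (Y : T -> B) (Z : T -> C) (M : nat)
    (u : A -> 'I_M) (v : C -> 'I_M) (p : R) : (2 <= M)%N ->
  measurable_fun setT X -> measurable_fun setT Y -> measurable_fun setT Z ->
  measurable_partition u -> measurable_partition v ->
  (forall t t', u (X t) = u (X t') -> X t = X t') ->
  fine (P [set t | u (X t) != v (Z t)]) <= p ->
  (CMI P X Y Z <= (Num.min (log2 M%:R) (Hbar p + p * log2 (M%:R - 1)))%:E)%E.
Proof.
move=> M2 mX mY mZ mu mv uinj; set pe := fine _ => pep.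
pose H := - \sum_k xlog2 (fine (P ((u \o X) @^-1` [set k]))).
have mU k := measurable_fiber k mX mu.
have MI1 : (MI P X (fun t => (Y t, Z t)) <= H%:E)%E.
  apply: ge_ereal_sup => _ [m [n [f [g [mf mg ->]]]]].
  rewrite lee_fin; apply: disc_MI_le_entropy => //.
  exact/measurable_fun_pair.
have MI2 : ((disc_MI P X Z u v)%:E <= MI P X Z)%E.
  by apply: ereal_sup_ubound; exists M, M, u, v.
have pe01 : 0 <= pe <= 1.
  rewrite fine_prob_ge0 /=.
  have -> : 1 = fine (P setT) by rewrite probability_setT.
  apply: le_fine_prob => //.
  rewrite (_ : [set t | _ != _] = ~` [set t | u (X t) = v (Z t)]).
    exact/measurableC/measurable_eq_fibers.
  by apply/seteqP; split=> t /= /eqP.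
(* For [M >= 2] the factor [log2 (M - 1)] is nonnegative, so Fano's bound may be enlarged from [pe]
   to [p]. *)
have M1 : 1 <= M%:R - 1 :> R by rewrite lerBrDr -[leLHS](natrD _ 1 1) ler_nat.
rewrite EFin_min le_min; apply/andP; split.
  apply: (@le_trans _ _ (H%:E - 0)%E).
    by apply: leeB => //; exact: MI_ge0.
  rewrite sube0 lee_fin; apply: entropy_le_log_card => [|i|].
  - exact: ltnW.
  - exact: fine_prob_ge0.
  - have <- : fine (P setT) = 1 by rewrite probability_setT.
    rewrite (@fine_prob_fibers _ _ _ P _ (u \o X)) //.
    by apply: eq_bigr => i _; rewrite setTI.
apply: (@le_trans _ _ (H%:E - (disc_MI P X Z u v)%:E)%E).
  by apply: leeB.
rewrite -EFinB lee_fin.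
have h := disc_MI_fano P M2 mX mZ mu mv; apply: (le_trans h).
apply: lerD; first exact: Hb_le_Hbar.
by apply: ler_wpM2r => //; exact: log2_ge0.
Qed.

(** * Scalar quantizers *)

Lemma measurable_neq_fun d (T : measurableType d) (R : realType) (f g : T -> R) :
  measurable_fun setT f -> measurable_fun setT g ->
  measurable [set t | f t != g t].
Proof.
move=> mf mg.
have /(_ measurableT [set false]) := measurable_fun_eqr mf mg.
rewrite setTI => h; rewrite (_ : [set t | _] = (fun t => f t == g t) @^-1` [set false]).
  exact: h.
by apply/seteqP; split=> t /=; case: eqP.
Qed.

Section Quantizer.
Variables (R : realType) (M : nat) (Q : R -> R) (L : seq R).
Hypotheses (uL : uniq L) (sL : size L = M) (QL : forall x, Q x \in L).
Hypothesis Qconv : forall x y w, x <= w -> w <= y -> Q x = Q y -> Q w = Q x.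

(** A preimage is a finite union of level sets, and these are intervals by [Qconv]. *)
Lemma measurable_quantizer : measurable_fun setT Q.
Proof.
move=> _ B mB; rewrite setTI.
have -> : Q @^-1` B = \big[setU/set0]_(l <- L | l \in B) Q @^-1` [set l].
  apply/seteqP; split=> x.
    move=> Bx; rewrite -bigcup_seq_cond; exists (Q x) => //=.
    by rewrite QL; apply/mem_set.
  rewrite -bigcup_seq_cond => -[l /= /andP[_ lB] ->]; exact: set_mem.
apply: bigsetU_measurable => l _; apply: is_interval_measurable.
move=> x y /= xl yl w /andP[xw wy].
by rewrite (Qconv xw wy) // xl.
Qed.

(** Discrete mutual informations use partitions into ['I_m], so levels are numbered by their
    position in [L]. *)
Lemma quantizer_index (M0 : (0 < M)%N) : exists u : R -> 'I_M,
  measurable_partition u /\ {in L &, injective u}.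
Proof.
case: M sL M0 => // m sLm _; pose u x : 'I_m.+1 := inord (index x L).
exists u; split; last first.
  move=> x y xL yL /(congr1 val); rewrite /= !inordK -?sLm ?index_mem //.
  exact: index_inj.
move=> i; have mfin (S : set R) : S `<=` [set` L] -> measurable S.
  move=> SL; apply: countable_measurable => //; apply: finite_set_countable.
  by apply: (sub_finite_set SL); exact: finite_seq.
(* Points outside [L] have the out-of-range position [size L], which [inord] sends to one default
   index. Every fibre of [u] is therefore a part of the finite set [L], with or without the whole
   complement of [L]. *)
have uC x y : x \notin L -> y \notin L -> u x = u y.
  by rewrite /u -!index_mem -!leqNgt => xL yL; congr inord; apply/eqP;
    rewrite eqn_leq (leq_trans (index_size _ _) yL) (leq_trans (index_size _ _) xL).
rewrite -[X in measurable X](setUIDK _ [set` L]).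
apply: measurableU; first by apply: mfin; exact: subIsetr.
have [[x [ux xL]]|h] := pselect (exists x, u x = i /\ x \notin L).
  suff -> : u @^-1` [set i] `\` [set` L] = ~` [set` L].
    by apply: measurableC; apply: mfin.
  apply/seteqP; split=> y; first by case.
  by move=> /negP yL; split; [rewrite /= -ux; exact: uC|exact/negP].
suff -> : u @^-1` [set i] `\` [set` L] = set0 by [].
apply/seteqP; split=> // y [uy /negP yL]; apply: h; by exists y.
Qed.

(** Were every level set bounded above, the largest of the finitely many bounds would bound the
    whole line. *)
Lemma quantizer_unbounded_level :
  exists2 l, l \in L & forall b, exists2 x, b < x & Q x = l.
Proof.
apply: contrapT => h.
have [b bP] : exists b, forall x, Q x \in L -> x <= b.
  have hb l : l \in L -> exists b, forall x, Q x = l -> x <= b.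
    move=> lL; apply: contrapT => hl; apply: h; exists l => // b.
    apply: contrapT => hx; apply: hl; exists b => x Qx.
    by rewrite leNgt; apply/negP => bx; apply: hx; exists x.
  elim: L hb => [|l s ih] hb; first by exists 0.
  have [b1 b1P] := hb l (mem_head _ _).
  have [|b2 b2P] := ih; first by move=> k ks; apply: hb; rewrite inE ks orbT.
  exists (Num.max b1 b2) => x; rewrite inE le_max => /predU1P[/b1P ->//|/b2P ->].
  by rewrite orbT.
have := bP (b + 1) (QL _); lra.
Qed.

Lemma measurable_quantizer_change (h : R) :
  measurable [set x | Q (h + x) != Q x].
Proof.
apply: measurable_neq_fun; last exact: measurable_quantizer.
by apply: (measurableT_comp measurable_quantizer); exact: measurable_funD.
Qed.

Lemma lebesgue_bigsetU_itv (s : seq R) (h : R) : 0 <= h ->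
  (lebesgue_measure (\big[setU/set0]_(b <- s) `[(b - h)%R, (b + h)%R]%classic)
    <= ((size s)%:R * (h *+ 2))%:E)%E.
Proof.
move=> h0; elim: s => [|b s ih]; first by rewrite big_nil measure0 mul0r.
rewrite big_cons; apply: (le_trans (measureU2 _ _ _)) => //.
  by apply: bigsetU_measurable.
rewrite /= -natr1 mulrDl mul1r addrC EFinD; apply: leeD => //.
rewrite lebesgue_measure_itv /= lte_fin; case: ifP => _.
  by rewrite -EFinB lee_fin; lra.
by rewrite lee_fin mulrn_wge0.
Qed.

(* A level crossed between [x] and [h + x] has its upper end within [|h|] of
   [x]; the level that is unbounded above is never crossed upwards, which
   leaves [M - 1] possible ends. *)
Lemma lebesgue_quantizer_change (h : R) :
  (lebesgue_measure [set x | Q (h + x) != Q x]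
    <= ((M%:R - 1) * (`|h| *+ 2))%:E)%E.
Proof.
have [l0 l0L l0P] := quantizer_unbounded_level.
(* A level that is never taken contributes the default [sup] of the empty set, which only enlarges
   the cover. *)
pose s := [seq sup (Q @^-1` [set l]) | l <- rem l0 L].
have -> : M%:R - 1 = (size s)%:R :> R.
  rewrite size_map size_rem // sL -subn1 natrB // -sL.
  by case: L l0L.
apply: le_trans (lebesgue_bigsetU_itv s (normr_ge0 h)).
apply: le_measure; rewrite ?inE.
- exact: measurable_quantizer_change.
- by apply: bigsetU_measurable.
move=> x /= Qne; rewrite -bigcup_seq /=.
pose a := Num.min x (h + x); pose c := Num.max x (h + x).
have ac : a <= c by rewrite /a /c; case: (leP x (h + x)); lra.
have Qac : Q a != Q c.
  by rewrite /a /c; case: (leP x (h + x)) => _ //; rewrite eq_sym.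
(* Beyond [c] the level of [a] cannot recur: by convexity [c] would share it. *)
have ubc y : Q y = Q a -> y <= c.
  move=> Qy; rewrite leNgt; apply/negP => cy; move: Qac.
  by rewrite (Qconv ac (ltW cy)) ?eqxx.
have supc : sup (Q @^-1` [set Q a]) <= c by apply: ge_sup; [exists a|exact: ubc].
have asup : a <= sup (Q @^-1` [set Q a]).
  by apply: ub_le_sup => //; exists c; exact: ubc.
exists (sup (Q @^-1` [set Q a])) => /=.
  apply/mapP; exists (Q a) => //; rewrite mem_rem_uniq // inE QL andbT.
  apply/eqP => e; have [y cy Qy] := l0P c.
  by have := ubc y; rewrite e Qy => /(_ erefl); rewrite leNgt cy.
move: supc asup; rewrite in_itv /= /a /c.
have := ler_norm h; have := ler_norm (- h); rewrite normrN.
by case: (leP x (h + x)) => *; apply/andP; split; lra.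
Qed.

End Quantizer.

(** * Gaussian measures *)

Section Gaussian.
Variable R : realType.
Local Notation mu := (@lebesgue_measure R).
Implicit Types (s x t : R) (A : set R).

(* Moving [A] onto the centred interval of the same length increases the
   integral of the density; [normal_pdf 0 s t] is the level at which the
   superlevel set of the density is [[-t, t]]. *)
Lemma normal_prob_bathtub s t A : s != 0 -> 0 <= t -> measurable A ->
  (normal_prob 0%R s A + (normal_pdf 0 s t * (t *+ 2))%:E
    <= normal_prob 0%R s `[(- t)%R, t]%classic + (normal_pdf 0 s t)%:E * mu A)%E.
Proof.
move=> s0 t0 mA; set I := `[(- t)%R, t]%classic; set c := normal_pdf 0 s t.
have c0 : 0 <= c by exact: normal_pdf_ge0.
have muI : mu I = (t *+ 2)%:E.
  rewrite /I lebesgue_measure_itv /= lte_fin; case: ifPn => h.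
    by rewrite -EFinB; congr EFin; lra.
  by congr EFin; move: h; rewrite -leNgt; lra.
have indE (B : set R) : measurable B ->
    (\int[mu]_x (c * \1_B x)%:E = c%:E * mu B)%E.
  move=> mB; under eq_integral do rewrite EFinM.
  rewrite ge0_integralZl //; first by rewrite integral_indic // setIT.
  by apply/measurable_EFinP; exact: measurable_indic.
have pdfE (B : set R) : measurable B ->
    (normal_prob 0%R s B = \int[mu]_x (normal_pdf 0 s x * \1_B x)%:E)%E.
  move=> mB; rewrite /normal_prob integral_mkcond; apply: eq_integral => x _.
  by rewrite patchE indicE; case: ifP => _; rewrite ?mulr1 ?mulr0.
have mpdf (B : set R) : measurable B ->
    measurable_fun setT (fun x => (normal_pdf 0 s x * \1_B x)%:E).
  move=> mB; apply/measurable_EFinP/measurable_funM.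
    exact: measurable_normal_pdf.
  exact: measurable_indic.
have mind (B : set R) : measurable B ->
    measurable_fun setT (fun x => (c * \1_B x)%:E).
  by move=> mB; apply/measurable_EFinP/measurable_funM => //; exact: measurable_indic.
have mI : measurable I by exact: measurable_itv.
(* The additive form avoids subtracting a possibly infinite [mu A]: each side is the integral of a
   nonnegative function, and the integrands are compared pointwise. *)
rewrite EFinM -muI !pdfE // -!indE // -!ge0_integralD //=;
  do ?[by move=> x _; rewrite lee_fin mulr_ge0 // normal_pdf_ge0];
  do ?[exact: mpdf]; do ?[exact: mind].
apply: ge0_le_integral => //=.
- by move=> x _; rewrite -EFinD lee_fin addr_ge0 // mulr_ge0 // normal_pdf_ge0.
- by apply: emeasurable_funD; [exact: mpdf|exact: mind].
- by apply: emeasurable_funD; [exact: mpdf|exact: mind].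
move=> x _; rewrite -!EFinD lee_fin.
have sq : (x \in I) = (x ^+ 2 <= t ^+ 2).
  rewrite mem_setE in_itv /= -ler_norml -[LHS]ler_sqr ?nnegrE //.
  by rewrite real_normK ?num_real.
have mono y z : y ^+ 2 <= z ^+ 2 -> normal_pdf 0 s z <= normal_pdf 0 s y.
  move=> yz; rewrite normal_pdfE // ler_wpM2l ?normal_peak_ge0 //.
  rewrite /normal_fun !subr0 ler_expR ler_wpM2r ?invr_ge0 ?mulrn_wge0 ?sqr_ge0 //.
  by rewrite lerN2.
(* The factor [normal_pdf 0 s x - c] is nonnegative on [I] and nonpositive off it, so [I] is the
   best set. *)
have : (normal_pdf 0 s x - c) * \1_A x <= (normal_pdf 0 s x - c) * \1_I x.
  rewrite !indicE sq; case: (leP (x ^+ 2) (t ^+ 2)) => [xt|tx].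
    have h := mono _ _ xt; rewrite ler_wpM2l ?subr_ge0 //.
    by case: (x \in A).
  have h := mono _ _ (ltW tx); rewrite ler_wnM2l ?subr_le0 //.
rewrite !mulrBl; lra.
Qed.

End Gaussian.

(** * The error function and Mills' bound *)

Section Erf.
Variable R : realType.
Local Notation mu := (@lebesgue_measure R).
Implicit Types (s x t a b : R).

Lemma measurable_gauss_EFin (D : set R) : measurable D ->
  measurable_fun D (fun x => (gauss_fun x)%:E : \bar R).
Proof.
move=> mD; apply/measurable_EFinP; apply: measurable_funTS.
exact: measurable_gauss_fun.
Qed.

Lemma integral_gauss_fin_num (D : set R) : measurable D ->
  (\int[mu]_(x in D) (gauss_fun x)%:E)%E \is a fin_num.
Proof.
move=> mD; apply: integrable_fin_num => //.
by apply: (integrableS measurableT) => //; exact: integrableT_gauss.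
Qed.

Lemma erfE b : 0 <= b ->
  (\int[mu]_(x in `[0%R, b]) (gauss_fun x)%:E = (Num.sqrt pi / 2 * erf b)%:E)%E.
Proof.
move=> b0; rewrite /erf b0 !mulrA divfK ?pnatr_eq0 // divff; last first.
  by rewrite gt_eqF // sqrtr_gt0 pi_gt0.
by rewrite mul1r fineK //; exact: integral_gauss_fin_num.
Qed.

Lemma integral_gauss_sym b : 0 <= b ->
  (\int[mu]_(x in `[(- b)%R, b]) (gauss_fun x)%:E = (Num.sqrt pi * erf b)%:E)%E.
Proof.
move=> b0; have nb0 : - b <= 0 by rewrite oppr_le0.
rewrite (@itv_bndbnd_setU _ _ (BLeft (- b)) (BRight 0) (BRight b)) ?bnd_simp //.
rewrite ge0_integral_setU //=; first last.
- apply/disj_setPS => x [] /=; rewrite !in_itv /=; lra.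
- by move=> x _; rewrite lee_fin gauss_fun_ge0.
- by apply: measurable_gauss_EFin; exact: measurableU.
rewrite integral_itv_obnd_cbnd; last exact: measurable_gauss_EFin.
rewrite -[X in `[_, X]]oppr0 integration_by_substitution_oppr //; last first.
  by apply: continuous_subspaceT; exact: continuous_gauss_fun.
under eq_integral do rewrite /= /gauss_fun sqrrN -/(gauss_fun _).
by rewrite erfE // -EFinD; congr EFin; lra.
Qed.

(** The substitution [x * k] turns the normal density of deviation [s] into [gauss_fun], up to the
    factor [1 / sqrt pi]. *)
Lemma normal_prob_itv_erf s t : 0 < s -> 0 <= t ->
  normal_prob 0 s `[(- t)%R, t]%classic = (erf (t / (s * Num.sqrt 2)))%:E.
Proof.
move=> s0 t0; set k := (s * Num.sqrt 2)^-1.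
have k0 : 0 < k by rewrite invr_gt0 mulr_gt0 // sqrtr_gt0.
have sqk : k ^+ 2 = (s ^+ 2 *+ 2)^-1.
  by rewrite exprVn exprMn sqr_sqrtr // mulr_natr.
have pi0 : 0 < Num.sqrt pi :> R by rewrite sqrtr_gt0 pi_gt0.
have peakE : normal_peak s = (Num.sqrt pi)^-1 * k.
  rewrite /normal_peak (_ : _ *+ 2 = pi * (s * Num.sqrt 2) ^+ 2); last first.
    by rewrite exprMn sqr_sqrtr // mulrA mulr_natr mulrC.
  by rewrite sqrtrM ?pi_ge0 // sqrtr_sqr ger0_norm ?mulr_ge0 ?(ltW s0) // invfM.
have pdfE x : normal_pdf 0 s x = (Num.sqrt pi)^-1 * (gauss_fun (x * k) * k).
  rewrite normal_pdfE ?gt_eqF // peakE -mulrA [k * _]mulrC; congr (_ * (_ * _)).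
  by rewrite /normal_fun subr0 /gauss_fun exprMn sqk mulNr.
rewrite /normal_prob; under eq_integral do rewrite pdfE EFinM.
have cg : continuous (fun x => gauss_fun (x * k) * k).
  move=> x; apply: cvgM; last exact: cvg_cst.
  apply: (@continuous_comp _ _ _ (fun x => x * k) gauss_fun).
    exact: mulrr_continuous.
  exact: continuous_gauss_fun.
rewrite ge0_integralZl //=; last 2 first.
- apply/measurable_EFinP/measurable_funTS; exact: (continuous_measurable_fun cg).
- by move=> x _; rewrite lee_fin mulr_ge0 ?gauss_fun_ge0 // ltW.
have derk : (( *%R^~ k : R -> R)^`()%classic = cst k).
  by apply/funext => z; rewrite derive1Mr // derive1_id mul1r.
have := @integration_by_substitution_increasing R (fun x => x * k)
  gauss_fun (- t) t.
rewrite mulNr derk => <-; first last.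
- by apply: continuous_subspaceT; exact: continuous_gauss_fun.
- split => //.
  + by apply: cvg_at_right_filter; apply: cvgM => //; exact: cvg_cst.
  + by apply: cvg_at_left_filter; apply: cvgM => //; exact: cvg_cst.
- exact: is_cvg_cst.
- exact: is_cvg_cst.
- by move=> z _; exact: cvg_cst.
- by move=> a b _ _ ab; rewrite ltr_pM2r.
- lra.
rewrite integral_gauss_sym ?mulr_ge0 // ?(ltW k0) // -EFinM mulKf //.
by rewrite gt_eqF.
Qed.

(** On [[b, +oo[] one has [b * gauss_fun x <= x * gauss_fun x], and the right side has the primitive
    [F], which vanishes at infinity. *)
Lemma erfc_mills b : 0 <= b -> b * erfc b <= gauss_fun b / Num.sqrt pi.
Proof.
move=> b0; have pi0 : 0 < Num.sqrt pi :> R by rewrite sqrtr_gt0 pi_gt0.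
have tailE : (\int[mu]_(x in `[b, +oo[) (gauss_fun x)%:E =
    (Num.sqrt pi / 2 * erfc b)%:E)%E.
  have := @integral0y_gauss R.
  rewrite (@itv_bndbnd_setU _ _ (BLeft 0) (BRight b) (BInfty _ false)) ?bnd_simp //.
  rewrite ge0_integral_setU //=; first last.
  - apply/disj_setPS => x [] /=; rewrite !in_itv /=; lra.
  - by move=> x _; rewrite lee_fin gauss_fun_ge0.
  - by apply: measurable_gauss_EFin; exact: measurableU.
  rewrite integral_itv_obnd_cbnd; last exact: measurable_gauss_EFin.
  rewrite erfE // => h; rewrite /erfc mulrBr mulr1 EFinB -h [X in (_ = X - _)%E]addeC addeK //.
pose F x : R := - (gauss_fun x / 2).
have dF x : is_derive (x : R^o) 1 (F : R^o -> R^o) (x * gauss_fun x).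
  have -> : F = (fun x => expR (- x ^+ 2) * (- 2^-1)).
    by apply/funext => y; rewrite /F /gauss_fun mulrN.
  apply: is_derive_eq.
  by rewrite scaler0 add0r /GRing.scale /= /gauss_fun; field.
have FTC : (\int[mu]_(x in `[b, +oo[) (x * gauss_fun x)%:E =
    (gauss_fun b / 2)%:E)%E.
  have cF : continuous F.
    by move=> y; apply: differentiable_continuous; apply/derivable1_diffP; have [] := dF y.
  rewrite (@ge0_continuous_FTC2y R _ F b 0).
  - by rewrite sub0e -EFinN opprK.
  - by move=> x bx; rewrite mulr_ge0 ?gauss_fun_ge0 // (le_trans b0).
  - apply: continuous_subspaceT => x; apply: cvgM; first exact: cvg_id.
    exact: continuous_gauss_fun.
  - rewrite /F -[X in _ --> X]oppr0 -[X in - X](mul0r 2^-1).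
    apply: cvgN; apply: cvgM; last exact: cvg_cst.
    exact: cvg_gauss_fun.
  - by move=> x _; have [] := dF x.
  - exact/cvg_at_right_filter/cF.
  - by move=> x _; rewrite derive1E; have [] := dF x.
have : (b%:E * \int[mu]_(x in `[b, +oo[) (gauss_fun x)%:E <=
    \int[mu]_(x in `[b, +oo[) (x * gauss_fun x)%:E)%E.
  rewrite -ge0_integralZl //=; last 2 first.
  - exact: measurable_gauss_EFin.
  - by move=> x _; rewrite lee_fin gauss_fun_ge0.
  apply: ge0_le_integral => //=.
  - by move=> x _; rewrite -EFinM lee_fin mulr_ge0 ?gauss_fun_ge0.
  - apply/measurable_EFinP; apply: measurable_funM => //.
    by apply: measurable_funTS; exact: measurable_gauss_fun.
  - apply/measurable_EFinP; apply: measurable_funM => //.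
    by apply: measurable_funTS; exact: measurable_gauss_fun.
  - move=> x; rewrite in_itv /= andbT => bx.
    by rewrite -EFinM lee_fin ler_wpM2r ?gauss_fun_ge0.
rewrite FTC tailE -EFinM lee_fin => h; rewrite ler_pdivlMr //.
have -> : b * erfc b * Num.sqrt pi = 2 * (b * (Num.sqrt pi / 2 * erfc b)).
  by field.
lra.
Qed.

(** With [b = a / sqrt 2], the other two terms of [fbar] are [2 * b] times the two sides of Mills'
    bound, with opposite signs. *)
Lemma erf_le_fbar M s : (1 <= M)%N -> 0 <= s ->
  erf ((M%:R - 1) * Num.sqrt s / Num.sqrt 2) <= fbar M s.
Proof.
move=> M1 s0; rewrite /fbar; set a := (M%:R - 1) * Num.sqrt s.
have M1' : 0 <= M%:R - 1 :> R by rewrite subr_ge0 ler1n.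
have a0 : 0 <= a by rewrite mulr_ge0.
have aE : (M%:R - 1) ^+ 2 * s = a ^+ 2 by rewrite exprMn sqr_sqrtr.
rewrite mulNr aE -addrA lerDl subr_ge0; set b := a / Num.sqrt 2.
have b0 : 0 <= b by rewrite divr_ge0.
have sq2 : Num.sqrt 2 ^+ 2 = 2 :> R by rewrite sqr_sqrtr.
have sq20 : 0 < Num.sqrt 2 :> R by rewrite sqrtr_gt0.
have aE' : a = Num.sqrt 2 * b by rewrite mulrC divfK ?gt_eqF.
have := erfc_mills b0; rewrite /gauss_fun => h.
have -> : Num.sqrt (2 / pi) = Num.sqrt 2 / Num.sqrt pi :> R.
  by rewrite sqrtrM // sqrtrV ?pi_ge0.
have -> : - (a ^+ 2 / 2) = - b ^+ 2 by rewrite aE' exprMn sq2; field.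
rewrite -mulrA (_ : _ / _ * _ = 2 * b * (expR (- b ^+ 2) / Num.sqrt pi)).
  rewrite (_ : a ^+ 2 * erfc b = 2 * b * (b * erfc b)).
    by apply: ler_wpM2l => //; rewrite mulr_ge0.
  by rewrite aE' exprMn sq2; ring.
rewrite -[X in _ = X * b * _]sq2 aE'; ring.
Qed.

End Erf.

(** * Integration against a measure with a density *)

Section Density.
Context d (T : measurableType d) (R : realType).
Variables (mu nu : {measure set T -> \bar R}) (p : T -> R).
Hypotheses (mp : measurable_fun setT p) (p0 : forall x, 0 <= p x).
Hypothesis nuE : forall A, measurable A -> (nu A = \int[mu]_(x in A) (p x)%:E)%E.

Import HBNNSimple.

Let integral_density_nnsfun (f : {nnsfun T >-> R}) :
  (\int[nu]_x (f x)%:E = \int[mu]_x ((f x)%:E * (p x)%:E))%E.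
Proof.
under [LHS]eq_integral do rewrite fimfunE -fsumEFin//.
rewrite [LHS]ge0_integral_fsum//; last 2 first.
- by move=> r; exact/measurable_EFinP/measurableT_comp.
- by move=> r x _; rewrite EFinM nnfun_muleindic_ge0.
under [RHS]eq_integral => x _.
  rewrite fimfunE -fsumEFin// muleC ge0_mule_fsumr; last first.
    by move=> r; rewrite EFinM nnfun_muleindic_ge0.
  over.
have mpE : measurable_fun setT (fun x => (p x)%:E) by exact/measurable_EFinP.
have mfr r : measurable_fun setT (fun x => (r * \1_(f @^-1` [set r]) x)%:E).
  by apply/measurable_EFinP; exact: measurableT_comp.
rewrite [RHS]ge0_integral_fsum//; last 2 first.
- by move=> r; exact: emeasurable_funM.
- move=> r x _; apply: mule_ge0; first by rewrite lee_fin.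
  by rewrite EFinM nnfun_muleindic_ge0.
apply: eq_fsbigr => r _; rewrite integralZl_indic_nnsfun//= integral_indic// setIT.
(* Taking the scalar [r] out of the integral needs [0 <= r], which holds for a value of [f]; for any
   other [r] the fibre is empty. *)
have [->|[x <-]] : f @^-1` [set r] = set0 \/ exists x, f x = r.
- have [h|/set0P[x <-]] := eqVneq (f @^-1` [set r]) set0; first by left.
  by right; exists x.
- rewrite measure0 mule0 integral0_eq // => x _.
  by rewrite indic0 mulr0 mule0.
rewrite nuE // [in LHS]integral_mkcond -ge0_integralZl ?lee_fin //.
- apply: eq_integral => y _; rewrite patchE indicE.
  by case: ifP => _; rewrite ?(mulr1, mulr0, mule0) // muleC.
- by apply/(measurable_restrictT _ _).1 => //; exact: measurable_funTS.
- by move=> y _; rewrite patchE; case: ifP => _; rewrite ?lee_fin.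
Qed.

(** Simple functions increase to [f], and both sides pass to the limit by monotone convergence. *)
Lemma ge0_integral_density (f : T -> \bar R) :
  measurable_fun setT f -> (forall x, 0 <= f x)%E ->
  (\int[nu]_x f x = \int[mu]_x (f x * (p x)%:E))%E.
Proof.
move=> mf f0; pose g := nnsfun_approx measurableT mf.
have gf x : (EFin \o g^~ x @ \oo --> f x)%classic by exact: cvg_nnsfun_approx.
have ndg x : {homo (fun n => (g n x)%:E) : m n / (m <= n)%N >-> (m <= n)%E}.
  by move=> m n mn; rewrite lee_fin; exact/lefP/nd_nnsfun_approx.
transitivity (lim (\int[nu]_x (g n x)%:E @[n --> \oo])%E).
  rewrite -monotone_convergence //=.
  - by apply: eq_integral => x _; apply/esym/cvg_lim => //; exact: gf.
  - by move=> n; exact/measurable_EFinP/measurable_funTS.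
  - by move=> n x _; rewrite lee_fin.
under eq_fun do rewrite integral_density_nnsfun.
rewrite -monotone_convergence //=.
- apply: eq_integral => x _; apply/cvg_lim => //.
  by apply: cvgeZr; [|exact: gf].
- move=> n; apply: emeasurable_funM; first exact/measurable_EFinP/measurable_funTS.
  exact/measurable_EFinP.
- by move=> n x _; rewrite mule_ge0 ?lee_fin.
- by move=> x _ m n mn; rewrite lee_wpmul2r ?lee_fin //; exact: ndg.
Qed.

End Density.

(** * Translation and convolution of Gaussian measures *)

Section Convolution.
Variable R : realType.
Local Notation mu := (@lebesgue_measure R).
Implicit Types (a b s x y : R) (B : set R).

(** Lebesgue measure is determined by the lengths of half-open intervals, which translation
    preserves. The map is packaged as [phi] so that its pushforward is a measure. *)
Lemma lebesgue_measure_shift x B : measurable B ->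
  pushforward mu (+%R x : _ -> measurableTypeR R) B = mu B.
Proof.
move=> mB.
have mx : measurable_fun setT (+%R x : measurableTypeR R -> measurableTypeR R).
  exact: measurable_funD.
pose phi : {mfun measurableTypeR R >-> measurableTypeR R} :=
  HB.pack (+%R x : measurableTypeR R -> measurableTypeR R)
    (isMeasurableFun.Build _ _ _ _ _ mx).
rewrite -[LHS]/(pushforward mu phi B).
apply/esym/lebesgue_measure_unique => //= _ [[u v]] _ <-.
rewrite /pushforward (_ : _ @^-1` _ = `]u - x, v - x]%classic); last first.
  by apply/seteqP; split=> y /=; rewrite !in_itv /= ltrBlDl lerBrDl.
rewrite !lebesgue_measure_itv/= !lte_fin ltrD2r; case: ifP => // _.
by rewrite -!EFinB; congr EFin; lra.
Qed.

Lemma normal_prob_shift s x B : s != 0 -> measurable B ->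
  normal_prob 0 s [set y | B (x + y)] = normal_prob x s B.
Proof.
move=> s0 mB; rewrite /normal_prob.
transitivity (\int[pushforward mu (+%R x : _ -> measurableTypeR R)]_(y in B)
   (normal_pdf x s y)%:E)%E; last first.
  apply: eq_measure_integral => [|mx A mA _]; first exact: measurable_funD.
  exact: lebesgue_measure_shift.
rewrite ge0_integral_pushforward //=.
- apply: eq_integral => y _ /=.
  by rewrite !normal_pdfE // /normal_fun subr0 [x + y]addrC addrK.
- exact: measurable_funD.
- by apply/measurable_EFinP/measurable_funTS; exact: measurable_normal_pdf.
- by move=> y _; rewrite lee_fin normal_pdf_ge0.
Qed.

(* Completing the square in [x]. *)
Lemma normal_pdfM a b x y : 0 < a -> 0 < b ->
  normal_pdf 0 (Num.sqrt a) x * normal_pdf x (Num.sqrt b) y =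
  normal_pdf 0 (Num.sqrt (a + b)) y *
  normal_pdf (y * (a / (a + b))) (Num.sqrt (a * b / (a + b))) x.
Proof.
move=> a0 b0; have ab0 : 0 < a + b by rewrite addr_gt0.
have c0 : 0 < a * b / (a + b) by rewrite divr_gt0 // mulr_gt0.
have an0 : a != 0 by rewrite gt_eqF.
have bn0 : b != 0 by rewrite gt_eqF.
have abn0 : a + b != 0 by rewrite gt_eqF.
have expE : - (x - 0) ^+ 2 / (a *+ 2) + - (y - x) ^+ 2 / (b *+ 2) =
    - (y - 0) ^+ 2 / ((a + b) *+ 2) +
    - (x - y * (a / (a + b))) ^+ 2 / (a * b / (a + b) *+ 2).
  rewrite !subr0; field.
  by rewrite an0 bn0 abn0.
have peakE (v : R) : 0 < v ->
    normal_peak (Num.sqrt v) = (Num.sqrt v * Num.sqrt (pi *+ 2))^-1.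
  move=> v0; rewrite /normal_peak sqr_sqrtr ?ltW // -mulrnAr sqrtrM // ltW //.
have pdfE (v m u : R) : 0 < v -> normal_pdf m (Num.sqrt v) u =
    (Num.sqrt v * Num.sqrt (pi *+ 2))^-1 * expR (- (u - m) ^+ 2 / (v *+ 2)).
  move=> v0; rewrite normal_pdfE ?peakE //; last by rewrite gt_eqF // sqrtr_gt0.
  by rewrite /normal_fun sqr_sqrtr ?ltW.
rewrite !pdfE // mulrACA [RHS]mulrACA -!expRD expE -!invfM; congr (_^-1 * _).
rewrite mulrACA [RHS]mulrACA -(sqrtrM _ (ltW a0)) -(sqrtrM _ (ltW ab0)).
by congr (Num.sqrt _ * _); field.
Qed.

Lemma measurable_normal_pdf2 s : s != 0 ->
  measurable_fun setT (fun u : R * R => normal_pdf u.1 s u.2).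
Proof.
move=> s0; under eq_fun do rewrite normal_pdfE // /normal_fun.
apply: measurable_funM => //; apply: measurableT_comp => //.
apply: measurable_funM => //; apply: measurableT_comp => //.
by apply: measurable_funX; apply: measurable_funB.
Qed.

(** After Tonelli's theorem and completing the square, the factor depending on the inner variable
    [x] is a normal density and integrates to one. *)
Lemma normal_prob_conv a b B : 0 < a -> 0 < b -> measurable B ->
  (\int[mu]_x (normal_prob x (Num.sqrt b) B * (normal_pdf 0 (Num.sqrt a) x)%:E)
    = normal_prob 0%R (Num.sqrt (a + b)) B)%E.
Proof.
move=> a0 b0 mB.
have sb0 : Num.sqrt b != 0 by rewrite gt_eqF // sqrtr_gt0.
pose f (u : R * R) : \bar R :=
  (normal_pdf 0 (Num.sqrt a) u.1 * normal_pdf u.1 (Num.sqrt b) u.2 * \1_B u.2)%:E.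
have f0 u : (0 <= f u)%E by rewrite lee_fin !mulr_ge0 ?normal_pdf_ge0.
have mf : measurable_fun setT f.
  apply/measurable_EFinP; apply: measurable_funM.
    apply: measurable_funM; last exact: measurable_normal_pdf2.
    by apply: measurableT_comp => //; exact: measurable_normal_pdf.
  by apply: measurableT_comp => //; exact: measurable_indic.
transitivity (\int[mu]_x \int[mu]_y f (x, y))%E.
  apply: eq_integral => x _; rewrite /normal_prob muleC -ge0_integralZl //=.
  - rewrite integral_mkcond; apply: eq_integral => y _; rewrite patchE /f /= indicE.
    by case: ifP => _; rewrite ?(mulr1, mulr0).
  - by apply/measurable_EFinP/measurable_funTS; exact: measurable_normal_pdf.
  - by move=> y _; rewrite lee_fin normal_pdf_ge0.
  - by rewrite lee_fin normal_pdf_ge0.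
rewrite fubini_tonelli // /normal_prob [RHS]integral_mkcond.
apply: eq_integral => y _; rewrite patchE /f /=.
under eq_integral do rewrite normal_pdfM // mulrAC EFinM.
rewrite ge0_integralZl //=.
- by rewrite integral_normal_pdf mule1 indicE; case: ifP; rewrite ?(mulr1, mulr0).
- by apply/measurable_EFinP; exact: measurable_normal_pdf.
- by move=> x _; rewrite lee_fin normal_pdf_ge0.
- by rewrite lee_fin mulr_ge0 // normal_pdf_ge0.
Qed.

End Convolution.

(** * Law of the noise and error probability *)

Section JointLaw.
Context dA dB (A : measurableType dA) (B : measurableType dB) (R : realType).
Variables (nu1 : probability A R) (nu2 : probability B R).

Lemma scaled_product_measure_unique (m : {measure set (A * B) -> \bar R}) (c : R) :
  0 < c ->
  (forall C D, measurable C -> measurable D ->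
     m (C `*` D) = c%:E * (nu1 C * nu2 D))%E ->
  forall X, measurable X -> m X = (c%:E * (nu1 \x nu2) X)%E.
Proof.
move=> c0 mE X mX; have ci0 : 0 <= c^-1 by rewrite invr_ge0 ltW.
rewrite (@product_measure_unique _ _ _ _ R nu1 nu2 (mscale (NngNum ci0) m)) //.
  by rewrite /mscale /= muleA -EFinM divff ?mul1e // gt_eqF.
move=> C D mC mD; rewrite /= /mscale /= mE // muleA -EFinM mulVf ?mul1e //.
by rewrite gt_eqF.
Qed.

Lemma joint_law_on d (T : measurableType d) (P : probability T R)
    (E : set T) (U : T -> A) (V : T -> B) :
  measurable E -> measurable_fun setT U -> measurable_fun setT V ->
  (forall C D, measurable C -> measurable D ->
     P (E `&` (U @^-1` C `&` V @^-1` D)) = P E * (nu1 C * nu2 D))%E ->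
  forall X : set (A * B), measurable X ->
    (P (E `&` [set t | X (U t, V t)]) = P E * (nu1 \x nu2) X)%E.
Proof.
move=> mE mU mV indep X mX.
have mUV : measurable_fun setT (fun t => (U t, V t)) by exact/measurable_fun_pair.
have mX' : measurable [set t | X (U t, V t)].
  by rewrite -[X in measurable X]setTI; exact: mUV.
(* The uniqueness argument divides by [P E], so a null [E] is treated apart. *)
have [PE0|PE0] := eqVneq (P E) 0%E.
  rewrite PE0 mul0e; apply/eqP; rewrite eq_le measure_ge0 andbT -PE0.
  by apply: le_measure; rewrite ?inE //; exact: measurableI.
have PEfin : P E \is a fin_num by exact: fin_num_measure.
have c0 : 0 < fine (P E).
  by rewrite fine_gt0 // lt0e PE0 measure_ge0 /= -ge0_fin_numE.
rewrite -[P E in RHS]fineK // setIC.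
rewrite -[LHS]/(pushforward (mrestr P mE) (fun t => (U t, V t)) X).
apply: scaled_product_measure_unique => // C D mC mD.
by rewrite fineK // -indep // setIC.
Qed.

End JointLaw.

(** * Law of the total noise, jointly with [r] *)

Section SumLaw.
Context d (T : measurableType d) (R : realType) (P : probability T R).
Variables (r z n : T -> R).
Hypotheses (mr : measurable_fun setT r) (mz : measurable_fun setT z)
  (mn : measurable_fun setT n).
Hypothesis hind : mutually_independent3 P r z n.
Variables (a b : R).
Hypotheses (a0 : 0 <= a) (b0 : 0 < b).
Hypotheses (hz : has_gaussian_law P z a) (hn : has_gaussian_law P n b).

Let sb0 : Num.sqrt b != 0. Proof. by rewrite gt_eqF // sqrtr_gt0. Qed.

Let sumset (B : set R) : set (measurableTypeR R * measurableTypeR R) :=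
  [set u | B (u.1 + u.2)].

Let measurable_sumset B : measurable B -> measurable (sumset B).
Proof.
move=> mB; rewrite -[X in measurable X]setTI.
by apply: (_ : measurable_fun setT (fun u : R * R => u.1 + u.2)) => //;
  exact: measurable_funD.
Qed.

Let normal_prob_xsection_sumset B x : measurable B ->
  normal_prob 0 (Num.sqrt b) (xsection (sumset B) x) = normal_prob x (Num.sqrt b) B.
Proof.
move=> mB; have -> : xsection (sumset B) x = [set y | B (x + y)].
  by apply/seteqP; split=> y; rewrite /xsection /= inE.
exact: normal_prob_shift.
Qed.

(** The law [nu] of [z] stays abstract to cover both a Dirac mass and a Gaussian with a density. *)
Let sum_law_conv (nu : probability (measurableTypeR R) R) (A B : set R) :
  measurable A -> measurable B ->
  (forall C : set R, measurable C -> P (z @^-1` C) = nu C) ->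
  (P (r @^-1` A `&` (fun t => z t + n t)%R @^-1` B) =
   P (r @^-1` A) * \int[nu]_x normal_prob x (Num.sqrt b) B)%E.
Proof.
move=> mA mB nuE.
have mrA : measurable (r @^-1` A) by rewrite -[X in measurable X]setTI; exact: mr.
have nE C : measurable C -> P (n @^-1` C) = normal_prob 0 (Num.sqrt b) C.
  by move=> mC; rewrite hn // /gaussian_law gt_eqF.
have prodE : (nu \x normal_prob 0%R (Num.sqrt b))%E (sumset B) =
    (\int[nu]_x normal_prob x (Num.sqrt b) B)%E.
  by apply: eq_integral => x _; exact: normal_prob_xsection_sumset.
rewrite -prodE.
apply: (@joint_law_on _ _ (measurableTypeR R) (measurableTypeR R) R nu
  (normal_prob 0 (Num.sqrt b)) _ T P (r @^-1` A) z n mrA mz mn _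
  (sumset B) (measurable_sumset mB)).
move=> C D mC mD; rewrite setIA.
rewrite (hind mA mC mD) (nuE C mC) (nE D mD) -muleA.
reflexivity.
Qed.

Lemma independent_sum_law (A B : set R) : measurable A -> measurable B ->
  (P (r @^-1` A `&` (fun t => z t + n t)%R @^-1` B) =
   P (r @^-1` A) * normal_prob 0%R (Num.sqrt (a + b)) B)%E.
Proof.
move=> mA mB.
have mconv : measurable_fun setT (fun x => normal_prob x (Num.sqrt b) B).
  have := measurable_fun_xsection (normal_prob 0 (Num.sqrt b)) (measurable_sumset mB).
  by apply: eq_measurable_fun => x _; exact: normal_prob_xsection_sumset.
have [a_eq0|an0] := eqVneq a 0.
  rewrite (@sum_law_conv (\d_(0 : measurableTypeR R))) //.
    by rewrite integral_dirac // diracT mul1e a_eq0 add0r.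
  by move=> C mC; rewrite hz // /gaussian_law a_eq0 eqxx.
have a1 : 0 < a by rewrite lt_neqAle eq_sym an0.
rewrite (@sum_law_conv (normal_prob 0 (Num.sqrt a))) //; last first.
  by move=> C mC; rewrite hz // /gaussian_law (negbTE an0).
congr (_ * _)%E; rewrite -normal_prob_conv //.
apply: ge0_integral_density => //; first exact: measurable_normal_pdf.
by move=> x; exact: normal_pdf_ge0.
Qed.

End SumLaw.

(** * Bound on the probability that [r] changes the quantizer output *)

Section ErrorProbability.
Context d (T : measurableType d) (R : realType) (P : probability T R).
Variables (M : nat) (Q : R -> R) (L : seq R).
Hypotheses (M1 : (1 <= M)%N) (uL : uniq L) (sL : size L = M).
Hypothesis (QL : forall x, Q x \in L).
Hypothesis Qconv : forall x y w, x <= w -> w <= y -> Q x = Q y -> Q w = Q x.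

Lemma normal_prob_quantizer_change (s t h : R) : 0 < s -> 0 <= t ->
  (normal_prob 0%R s [set x | Q (h + x)%R != Q x]
     + (normal_pdf 0 s t * (t *+ 2))%:E
   <= (erf (t / (s * Num.sqrt 2))
        + normal_pdf 0 s t * ((M%:R - 1) * (`|h| *+ 2)))%:E)%E.
Proof.
move=> s0 t0; have mA := measurable_quantizer_change QL Qconv h.
have sn0 : s != 0 by rewrite gt_eqF.
apply: (le_trans (normal_prob_bathtub sn0 t0 mA)).
rewrite (normal_prob_itv_erf s0 t0) EFinD; apply: leeD => //.
rewrite EFinM; apply: lee_wpmul2l; first by rewrite lee_fin normal_pdf_ge0.
exact: (lebesgue_quantizer_change uL sL QL Qconv).
Qed.

Variables (r W : T -> R) (s v : R).
Hypotheses (mr : measurable_fun setT r) (mW : measurable_fun setT W) (s0 : 0 < s).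
Hypothesis joint : forall A B : set R, measurable A -> measurable B ->
  (P (r @^-1` A `&` W @^-1` B) = P (r @^-1` A) * normal_prob 0%R s B)%E.
Hypothesis hr : (\int[P]_t ((r t) ^+ 2)%:E <= v%:E)%E.

Let errset : set (measurableTypeR R * measurableTypeR R) :=
  [set u | Q (u.1 + u.2)%R != Q u.2].

Let measurable_errset : measurable errset.
Proof.
have mQ := measurable_quantizer QL Qconv.
apply: (@measurable_neq_fun _ (measurableTypeR R * measurableTypeR R)%type).
  apply: (measurableT_comp mQ).
  exact: measurable_funD.
exact: (measurableT_comp mQ).
Qed.

Let xsection_errset x : xsection errset x = [set y | Q (x + y) != Q y].
Proof. by apply/seteqP; split=> y; rewrite /xsection /= inE. Qed.

Lemma measurable_cond_error_prob :
  measurable_fun setT (fun t => normal_prob 0%R s [set x | Q (r t + x)%R != Q x]).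
Proof.
have mf := measurable_fun_xsection (normal_prob 0 s) measurable_errset.
apply: (eq_measurable_fun (fun t => normal_prob 0%R s (xsection errset (r t)))).
  by move=> t _; rewrite xsection_errset.
exact: (measurableT_comp mf mr).
Qed.

(** By independence the law of [(r, W)] is a product measure, which integrates the measures of the
    sections of [errset]. *)
Lemma error_prob_integral :
  (P [set t | Q (r t + W t)%R != Q (W t)] =
   \int[P]_t normal_prob 0%R s [set x | Q (r t + x)%R != Q x])%E.
Proof.
have mr' : measurable_fun setT (r : T -> measurableTypeR R) by exact: mr.
pose phi : {mfun T >-> measurableTypeR R} :=
  HB.pack (r : T -> measurableTypeR R) (isMeasurableFun.Build _ _ _ _ _ mr').
transitivity ((distribution P phi \x normal_prob 0%R s)%E errset).
  rewrite -[RHS]mul1e -(@probability_setT _ _ _ P).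
  rewrite -(@joint_law_on _ _ (measurableTypeR R) (measurableTypeR R) R
    (distribution P phi) (normal_prob 0 s) _ T P setT r W measurableT mr mW _
    errset measurable_errset).
    by rewrite setTI.
  move=> C D mC mD; rewrite setTI.
  rewrite (joint mC mD) probability_setT mul1e.
  reflexivity.
transitivity (\int[distribution P phi]_x (normal_prob 0%R s \o xsection errset) x)%E.
  reflexivity.
rewrite ge0_integral_distribution.
- by apply: eq_integral => t _ /=; rewrite xsection_errset.
- exact: (measurable_fun_xsection (normal_prob 0 s) measurable_errset).
- by move=> y /=; apply: measure_ge0.
Qed.

(** The bound for fixed [h] is affine in [|h|], while only a second moment is given; AM-GM with
    weight [w] near [sqrt v] replaces [|h|] by a quadratic. The choice [tau = (M - 1) * sqrt v]
    makes the terms in [c] cancel in the limit. *)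
Lemma error_prob_le_erf :
  (P [set t | Q (r t + W t)%R != Q (W t)] <=
    (erf ((M%:R - 1) * Num.sqrt v / (s * Num.sqrt 2)))%:E)%E.
Proof.
have mE : measurable [set t | Q (r t + W t) != Q (W t)].
  have mQ := measurable_quantizer QL Qconv.
  apply: measurable_neq_fun; apply: (measurableT_comp mQ) => //.
  exact: measurable_funD.
have v0 : 0 <= v.
  by rewrite -lee_fin; apply: le_trans hr; apply: integral_ge0 => t _; rewrite lee_fin sqr_ge0.
have m0 : 0 <= M%:R - 1 :> R by rewrite subr_ge0 ler1n.
set tau := (M%:R - 1) * Num.sqrt v; set c := normal_pdf 0 s tau.
have tau0 : 0 <= tau by rewrite mulr_ge0.
have c0 : 0 <= c by exact: normal_pdf_ge0.
set K := erf _; set Pe := P _.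
have PeE : Pe = (fine Pe)%:E by rewrite fineK // fin_num_measure.
have K0 : 0 <= K.
  by rewrite -lee_fin -normal_prob_itv_erf //; apply: integral_ge0 => x _;
    rewrite lee_fin normal_pdf_ge0.
have bound e : 0 < e -> fine Pe <= K + c * (M%:R - 1) * e.
  (* The summand [e] keeps the divisor [w] positive even when [v = 0]. *)
  move=> e0; set w := Num.sqrt v + e.
  have w0 : 0 < w by rewrite ltr_wpDl.
  pose al := c * (M%:R - 1) / w; pose be := K + c * (M%:R - 1) * w.
  have al0 : 0 <= al by rewrite !mulr_ge0 // invr_ge0 ltW.
  have be0 : 0 <= be by rewrite addr_ge0 // !mulr_ge0 // ltW.
  have pw h : (normal_prob 0%R s [set x | Q (h + x)%R != Q x] + (c * (tau *+ 2))%:E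
      <= be%:E + al%:E * (h ^+ 2)%:E)%E.
    apply: (le_trans (normal_prob_quantizer_change h s0 tau0)).
    rewrite -/c -/K -EFinM -EFinD lee_fin /be /al -addrA lerD2l.
    have -> : c * (M%:R - 1) * w + c * (M%:R - 1) / w * h ^+ 2 =
        c * ((M%:R - 1) * (w + h ^+ 2 / w)) by ring.
    rewrite ler_wpM2l // ler_wpM2l //.
    (* AM-GM: [2 |h| <= w + h^2 / w] *)
    rewrite -[h ^+ 2]real_normK ?num_real // -subr_ge0.
    have -> : w + `|h| ^+ 2 / w - `|h| *+ 2 = (w - `|h|) ^+ 2 / w.
      by field; rewrite gt_eqF.
    by rewrite divr_ge0 ?sqr_ge0 // ltW.
  have : (Pe + (c * (tau *+ 2))%:E <= be%:E + al%:E * v%:E)%E.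
    apply: (@le_trans _ _ (be%:E + al%:E * \int[P]_t ((r t) ^+ 2)%:E)%E); last first.
      by rewrite leeD2l // lee_wpmul2l // lee_fin.
    rewrite /Pe error_prob_integral.
    have cstE k : (\int[P]_t k%:E = k%:E)%E.
      by rewrite integral_cst // [X in (_ * X)%E](@probability_setT _ _ _ P) mule1.
    rewrite -[X in (_ + X <= _)%E]cstE -[X in (_ <= X + _)%E]cstE.
    have mr2 : measurable_fun setT (fun t => ((r t) ^+ 2)%:E).
      by apply/measurable_EFinP; exact: measurable_funX.
    have mfE := measurable_cond_error_prob.
    rewrite -ge0_integralZl //; last by move=> t _; rewrite lee_fin sqr_ge0.
    rewrite -!ge0_integralD //.
    - apply: ge0_le_integral => //=.
      + by move=> t _; rewrite adde_ge0 // lee_fin mulr_ge0 // mulrn_wge0.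
      + exact: emeasurable_funD.
      + apply: emeasurable_funD => //; exact: emeasurable_funM.
    - by move=> t _; rewrite mule_ge0 // lee_fin sqr_ge0.
    - exact: emeasurable_funM.
    - by move=> t _; rewrite lee_fin mulr_ge0 // mulrn_wge0.
  rewrite PeE -EFinM -!EFinD lee_fin => h.
  (* Since [v / w <= sqrt v], this term and the one in [be] exceed [c * (tau *+ 2)] by at most
     [c * (M - 1) * e]. *)
  have h2 : al * v <= c * (M%:R - 1) * Num.sqrt v.
    rewrite /al -mulrA ler_wpM2l ?mulr_ge0 // mulrC ler_pdivrMr //.
    by rewrite -{1}(sqr_sqrtr v0) expr2 ler_wpM2l // /w lerDl ltW.
  move: h h2; rewrite /be /tau /w mulrDr; lra.
apply/lee_addgt0Pr => e e0.
(* The coefficient of [e] is only known to be nonnegative; adding 1 makes it a valid divisor. *)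
have d0 : 0 < c * (M%:R - 1) + 1 by rewrite ltr_wpDl // mulr_ge0.
rewrite PeE -EFinD lee_fin; apply: le_trans (bound (e / (c * (M%:R - 1) + 1)) _) _.
  by rewrite divr_gt0.
rewrite lerD2l mulrA ler_pdivrMr //; lra.
Qed.

End ErrorProbability.

Theorem theorem2 (R : realType) (d : measure_display) (T : measurableType d)
  (P : probability T R) (r z n : T -> R)
  (mr : measurable_fun setT r) (mz : measurable_fun setT z)
  (mn : measurable_fun setT n)
  (Zc N0 Rc : R) (hZc : 0 <= Zc) (hN0 : 0 < N0)
  (hind : mutually_independent3 P r z n)
  (hz : has_gaussian_law P z Zc) (hn : has_gaussian_law P n N0)
  (hr : (\int[P]_t ((r t) ^+ 2)%:E <= Rc%:E)%E)
  (M : nat) (hM : (2 <= M)%N) (Q : R -> R) (hQ : scalar_quantizer M Q) :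
  (CMI P (fun t => Q (r t + z t + n t)%R) r (fun t => z t + n t)%R
     <= (iotabar M (Rc / (Zc + N0)))%:E)%E.
Proof.
case: hQ => L [uL sL QL Qconv].
have M0 : (0 < M)%N by rewrite ltnW.
have [u [mu uinj]] := quantizer_index sL M0.
have mQ := measurable_quantizer QL Qconv.
have mW : measurable_fun setT (fun t => z t + n t) by exact: measurable_funD.
have s2 : 0 < Zc + N0 by rewrite ltr_wpDl.
have s0 : 0 < Num.sqrt (Zc + N0) by rewrite sqrtr_gt0.
have Rc0 : 0 <= Rc.
  rewrite -lee_fin; apply: le_trans hr; apply: integral_ge0 => t _.
  by rewrite lee_fin sqr_ge0.
(* From the noise [W] alone, the output is guessed to be [Q W], its value at [r = 0]. *)
apply: (@CMI_le R d T P _ _ _ _ _ _ _ _ _ M u (u \o Q)) => //.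
- apply: (measurableT_comp mQ); apply: measurable_funD => //.
  exact: measurable_funD.
- by move=> i; exact: (measurable_fiber i mQ mu).
- by move=> t t' /uinj; apply; exact: QL.
(* Since [u] is injective on [L], indices differ exactly when levels do. *)
rewrite (_ : [set t | _] = [set t | Q (r t + (z t + n t)) != Q (z t + n t)]); last first.
  apply/seteqP; split=> t /=; rewrite addrA; apply: contra_neq; first by move->.
  by apply: uinj; exact: QL.
have joint := independent_sum_law mr mz mn hind hZc hN0 hz hn.
have err := error_prob_le_erf M0 uL sL QL Qconv mr mW s0 joint hr.
have mE : measurable [set t | Q (r t + (z t + n t)) != Q (z t + n t)].
  apply: measurable_neq_fun; apply: (measurableT_comp mQ) => //.
  exact: measurable_funD.
rewrite -lee_fin fineK ?fin_num_measure //; apply: (le_trans err); rewrite lee_fin.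
have -> : (M%:R - 1) * Num.sqrt Rc / (Num.sqrt (Zc + N0) * Num.sqrt 2) =
    (M%:R - 1) * Num.sqrt (Rc / (Zc + N0)) / Num.sqrt 2.
  by rewrite sqrtrM // sqrtrV ?(ltW s2) // invfM !mulrA.
by apply: erf_le_fbar => //; rewrite divr_ge0 // ltW.
Qed.
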